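(* Let $n\ge1$. For every $f,g\in\mathrm{QC}(\mathbb{R}^n)$ one has, pointwise on $\mathbb{R}^n$, $$(f\oplus g)^\ast\ge f^\ast\oplus g^\ast .$$
   Context: $\mathrm{QC}(\mathbb{R}^n)$ denotes the class of functions $f:\mathbb{R}^n\to[0,\infty)$ that are quasi-concave, i.e. $f(\lambda x+(1-\lambda)y)\ge\min\{f(x),f(y)\}$ for all $x,y\in\mathbb{R}^n$, $0\le\lambda\le1$, and which moreover are upper semicontinuous, satisfy $\max_{x\in\mathbb{R}^n} f(x)=1$, and $f(x)\to0$ as $|x|\to\infty$. The quasi-sum is $(f\oplus g)(x)=\sup_{y+z=x}\min\{f(y),g(z)\}$, which is again in $\mathrm{QC}(\mathbb{R}^n)$. For $0<t\le1$, $K_t(f)=\{x:f(x)\ge t\}$ (a nonempty compact convex set for $f\in\mathrm{QC}(\mathbb{R}^n)$). For a nonempty compact convex $K\subset\mathbb{R}^n$, $K^\ast=\left(\mathrm{Vol}(K)/\mathrm{Vol}(D)\right)^{1/n}D$, where $D$ is the closed Euclidean unit ball centered at the origin; i.e. $K^\ast$ is the centered ball of the same volume as $K$. For $f\in\mathrm{QC}(\mathbb{R}^n)$, the symmetric decreasing rearrangement $f^\ast\in\mathrm{QC}(\mathbb{R}^n)$ is the unique function with $K_t(f^\ast)=K_t(f)^\ast$ for all $0<t\le1$. *)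

(* Defs.v *)
From HB Require Import structures.
From mathcomp Require Import all_boot all_order all_algebra.
From mathcomp Require Import all_classical all_reals all_analysis.

Set Implicit Arguments.
Unset Strict Implicit.
Unset Printing Implicit Defensive.

Import Order.TTheory GRing.Theory Num.Theory.
Import numFieldNormedType.Exports.

Local Open Scope classical_set_scope.
Local Open Scope ring_scope.

(** n-fold powers of a sigma-finite measure, on [n.-tuple T] with the product
    sigma-algebra. *)

Section power_measure_step.
Local Open Scope ereal_scope.
Context d (T : measurableType d) (R : realType) (n : nat).
Variables (m : {sigma_finite_measure set T -> \bar R})
  (mu : {sigma_finite_measure set (n.-tuple T) -> \bar R}).

Definition tuple_cons (p : T * n.-tuple T) : n.+1.-tuple T :=
  [the n.+1.-tuple T of p.1 :: p.2].

Lemma measurable_tuple_cons : measurable_fun [set: T * n.-tuple T] tuple_cons.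
Proof. exact: (measurable_cons measurable_fst measurable_snd). Qed.

Definition measure_cons : set (n.+1.-tuple T) -> \bar R :=
  pushforward (m \x mu) tuple_cons.

Let measure_cons0 : measure_cons set0 = 0.
Proof. by rewrite /measure_cons /pushforward preimage_set0 measure0. Qed.

Let measure_cons_ge0 A : 0 <= measure_cons A.
Proof. exact: (measure_ge0 (m \x mu)). Qed.

Let measure_cons_sigma_additive : semi_sigma_additive measure_cons.
Proof.
have mc := measurable_tuple_cons.
exact: measure_semi_sigma_additive.
Qed.

HB.instance Definition _ := isMeasure.Build _ _ _ measure_cons
  measure_cons0 measure_cons_ge0 measure_cons_sigma_additive.

Let measure_cons_sigma_finite : sigma_finite setT measure_cons.
Proof.
have /sigma_finiteP[F [FT ndF Foo]] := sigma_finiteT m.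
have /sigma_finiteP[G [GT ndG Goo]] := sigma_finiteT mu.
pose uncons (t : n.+1.-tuple T) : T * n.-tuple T :=
  (tnth t ord0, [tuple of behead t]).
have muncons : measurable_fun [set: n.+1.-tuple T] uncons.
  apply/measurable_fun_pair; first exact: measurable_tnth.
  exact: measurable_behead.
exists (fun k => uncons @^-1` (F k `*` G k)).
  apply/esym; rewrite -subTset => t _.
  have [i _ Fi] : (\bigcup_k F k) (uncons t).1 by rewrite -FT.
  have [j _ Gj] : (\bigcup_k G k) (uncons t).2 by rewrite -GT.
  exists (maxn i j) => //; split.
  - by move: Fi; exact/subsetPset/ndF/leq_maxl.
  - by move: Gj; exact/subsetPset/ndG/leq_maxr.
move=> k; have [mF Fk] := Foo k; have [mG Gk] := Goo k; split.
  by rewrite -[X in measurable X]setTI; apply: muncons => //; exact: measurableX.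
rewrite /measure_cons /pushforward -comp_preimage (_ : _ \o _ = id).
  by rewrite preimage_id product_measure1E// lte_mul_pinfty// ge0_fin_numE.
by apply/funext => -[x t] /=; congr pair; exact: val_inj.
Qed.

HB.instance Definition _ := Measure_isSigmaFinite.Build _ _ _ measure_cons
  measure_cons_sigma_finite.

Definition power_measure_step :
  {sigma_finite_measure set (n.+1.-tuple T) -> \bar R} := measure_cons.

End power_measure_step.

Fixpoint power_measure d (T : measurableType d) (R : realType)
    (m : {sigma_finite_measure set T -> \bar R}) (n : nat) :
    {sigma_finite_measure set (n.-tuple T) -> \bar R} :=
  match n with
  | 0 => \d_([tuple] : 0.-tuple T)
  | k.+1 => power_measure_step m (power_measure m k)
  end.

Section rearrangement.
Context {R : realType} {n : nat}.
Local Notation Rn := 'rV[R]_n.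
Implicit Types (f g h : Rn -> R) (K : set Rn) (x y z : Rn).

Definition Vol K : \bar R :=
  power_measure (@lebesgue_measure R) n [set t | K (\row_i tnth t i)].

(** The canonical norm of ['rV[R]_n] is the sup norm, hence this definition. *)
Definition enorm x : R := Num.sqrt (\sum_i x ord0 i ^+ 2).

Definition unit_ball : set Rn := [set x | enorm x <= 1].

Definition quasi_concave f : Prop :=
  forall x y (l : R), 0 <= l -> l <= 1 ->
    Num.min (f x) (f y) <= f (l *: x + (1 - l) *: y).

Definition upper_semicontinuous f : Prop :=
  forall x (a : R), f x < a -> \forall y \near x, f y < a.

Definition vanishes_at_infinity f : Prop :=
  forall e : R, 0 < e -> exists M : R, forall x, M < enorm x -> `|f x| < e.

Definition QC f : Prop :=
  [/\ forall x, 0 <= f x, quasi_concave f, upper_semicontinuous f,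
      (exists x, f x = 1) /\ (forall x, f x <= 1) & vanishes_at_infinity f].

Definition quasi_sum f g : Rn -> R := fun x =>
  sup [set r | exists y z, y + z = x /\ r = Num.min (f y) (g z)].

Definition superlevel (t : R) f : set Rn := [set x | t <= f x].

Definition ball_rearrangement K : set Rn :=
  [set ((fine (Vol K) / fine (Vol unit_ball)) `^ (n%:R^-1)) *: x
     | x in unit_ball].

Definition is_rearrangement f h : Prop :=
  QC h /\ forall t : R, 0 < t -> t <= 1 ->
    superlevel t h = ball_rearrangement (superlevel t f).

(** Definite description: the default value [0] is only taken if no function
    satisfies [is_rearrangement f]. *)
Definition rearrangement f : Rn -> R :=
  xget (fun=> 0) [set h | is_rearrangement f h].

End rearrangement.

(* Main.v *)
Require Import Defs.
From mathcomp Require Import all_boot all_order all_algebra.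
From mathcomp Require Import all_classical all_reals all_analysis.
From mathcomp Require Import measurable_realfun.
From mathcomp Require Import ring lra.
Set Implicit Arguments.
Unset Strict Implicit.
Unset Printing Implicit Defensive.
Import Order.TTheory GRing.Theory Num.Theory.
Import numFieldNormedType.Exports.
Local Open Scope classical_set_scope.
Local Open Scope ring_scope.

(** Write $r_t(F)$ for the radius of the centered ball with the volume of
    $K_t(F)$. Whenever the superlevel sets of $F$ at positive levels are closed
    and bounded, the function whose superlevel sets are the balls of radius
    $r_t(F)$ exists and lies in QC: these radii decrease with $t$, and they are
    left-continuous because $K_t(F)$ is the decreasing intersection of the
    $K_s(F)$ with $s < t$ (radius_left_continuous,
    is_rearrangement_rearrangement). The quasi-sum qualifies, since for
    $t > 0$ its superlevel set is the intersection over $0 < s < t$ of the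
    compact sets $K_s(f) + K_s(g)$ (superlevel_quasi_sum). The inequality of
    functions thus reduces to an inequality of radii: $f^*(y) \ge t$ and
    $g^*(z) \ge t$ mean $|y| \le r_t(f)$ and $|z| \le r_t(g)$, while
    $(f \oplus g)^*(y + z) \ge t$ means $|y + z| \le r_t(f \oplus g)$. As
    $K_t(f \oplus g)$ contains $K_t(f) + K_t(g)$, what is left is the
    Brunn-Minkowski inequality.

    The Brunn-Minkowski inequality (brunn_minkowski) holds for bounded
    measurable sets and is proved by induction on the dimension, slicing along
    the first coordinate. If $p^n$ and $q^n$ are the suprema of the slice
    volumes of $A$ and $B$, then for $0 < v < 1$ a slice of $A$ of volume at
    least $v p^n$ and one of $B$ of volume at least $v q^n$ add up, by
    induction, to part of a slice of $C$ of volume at least $v (p + q)^n$. The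
    one-dimensional inequality bounds the length of the set of such slices of
    $C$ from below by the sum of the two lengths, and integrating over $v$
    (layer_cake) gives
    $|C| \ge (p + q)^n (|A| / p^n + |B| / q^n)$.
    Radon's inequality (radon_inequality) turns this into the claim for
    dimension $n + 1$. *)

(** * Brunn-Minkowski on the line *)

Section real_line.
Context {R : realType}.
Local Open Scope ereal_scope.
Local Notation mu := (@lebesgue_measure R).
Implicit Types A B C : set (measurableTypeR R).

Lemma measurable_shift (v : R) :
  measurable_fun [set: measurableTypeR R]
    (fun x : R => (v + x)%R : measurableTypeR R).
Proof.
exact: (@measurable_funD _ (measurableTypeR R) R setT (cst v) id).
Qed.

Lemma lebesgue_measure_shift (v : R) A : measurable A ->
  mu [set x : R | A (v + x)%R] = mu A.
Proof.
move=> mA.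
have mv := measurable_shift v.
have -> : mu [set x : R | A (v + x)%R]
    = pushforward mu (fun x : measurableTypeR R => (v + x)%R : measurableTypeR R) A.
  by [].
apply/esym/lebesgue_measure_unique => //= _ [[a b]] _ <-.
rewrite /pushforward.
rewrite (_ : _ @^-1` _ = `](a - v)%R, (b - v)%R]%classic); last first.
  apply/seteqP; split => x /=; rewrite !in_itv /= => /andP[? ?];
    apply/andP; split; lra.
rewrite !lebesgue_measure_itv/= !lte_fin ltrD2r.
by case: ifP => // _; rewrite -!EFinB; congr (_%:E); ring.
Qed.

(** Both $A + y$ and $x + B$ lie in $C$ when $x \in A$ and $y \in B$. The
    closer $x$ is to $\sup A$ and $y$ to $\inf B$, the smaller their overlap:
    the part of $A + y$ up to $x + y$ and the part of $x + B$ beyond $x + y$ are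
    disjoint and lose arbitrarily little measure. *)
Lemma brunn_minkowski1 A B C (r : R) :
  measurable A -> measurable B -> measurable C ->
  A !=set0 -> B !=set0 ->
  (forall x, A x -> (`|x| <= r)%R) -> (forall x, B x -> (`|x| <= r)%R) ->
  (forall x y : R, A x -> B y -> C (x + y)%R) ->
  mu A + mu B <= mu C.
Proof.
move=> mA mB mC A0 B0 Ar Br ABC.
have supA : has_sup (A : set R).
  by split => //; exists r => x /Ar; rewrite ler_norml => /andP[].
have infB : has_inf (B : set R).
  by split => //; exists (- r)%R => x /Br; rewrite ler_norml => /andP[].
apply/lee_addgt0Pr => e e0.
have e20 : (0 < e / 2)%R by rewrite divr_gt0.
have [x Ax xe] := sup_adherent e20 supA.
have [y By ye] := inf_adherent e20 infB.
set a := sup _ in xe; set b := inf _ in ye.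
have Aa z : A z -> (z <= a)%R by move=> Az; apply: ub_le_sup => //; case: supA.
have Bb z : B z -> (b <= z)%R by move=> Bz; apply: ge_inf => //; case: infB.
pose A1 := A `&` `]-oo, x]%classic; pose B1 := B `&` `]y, +oo[%classic.
have mA1 : measurable A1 by apply: measurableI => //; exact: measurable_itv.
have mB1 : measurable B1 by apply: measurableI => //; exact: measurable_itv.
have hA : mu A <= mu A1 + (e / 2)%:E.
  have -> : (e / 2)%:E = mu `](a - e / 2)%R, a]%classic.
    rewrite lebesgue_measure_itv/= lte_fin ltrBlDr ltrDl e20 -EFinB.
    by congr (_%:E); ring.
  apply: le_trans (measureU2 _ _ _) => //.
  apply: le_measure; rewrite ?inE //; first exact: measurableU.
  move=> z Az; have [zx|zx] := leP z x; first by left; split => //=; rewrite in_itv.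
  by right => /=; rewrite in_itv /= Aa // andbT; lra.
have hB : mu B <= mu B1 + (e / 2)%:E.
  have -> : (e / 2)%:E = mu `[b, (b + e / 2)%R]%classic.
    rewrite lebesgue_measure_itv/= lte_fin ltrDl e20 -EFinB.
    by congr (_%:E); ring.
  apply: le_trans (measureU2 _ _ _) => //.
  apply: le_measure; rewrite ?inE //; first exact: measurableU.
  move=> z Bz; have [zx|zx] := ltP y z; first by left; split => //=; rewrite in_itv/= zx.
  by right => /=; rewrite in_itv /= Bb //=; lra.
pose A2 := [set z : R | A1 (- y + z)%R] : set (measurableTypeR R).
pose B2 := [set z : R | B1 (- x + z)%R] : set (measurableTypeR R).
have mA2 : measurable A2.
  by rewrite -[A2]setTI; apply: (measurable_shift (- y)%R).
have mB2 : measurable B2.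
  by rewrite -[B2]setTI; apply: (measurable_shift (- x)%R).
have dAB : [disjoint A2 & B2].
  apply/disj_setPS => z /= [[_ /=]]; rewrite in_itv /= => h1 [_ /=].
  by rewrite in_itv/= andbT => h2; lra.
have : mu A1 + mu B1 <= mu C.
  rewrite -(lebesgue_measure_shift (- y)%R mA1) -(lebesgue_measure_shift (- x)%R mB1).
  rewrite -[X in X <= _](measureU _ mA2 mB2); last exact/disj_set2P.
  apply: le_measure; rewrite ?inE //; first exact: measurableU.
  move=> z [[Az _]|[Bz _]].
    by have := ABC _ _ Az By; rewrite addrC addrA addrN add0r.
  by have := ABC _ _ Ax Bz; rewrite addrA addrN add0r.
move=> h; apply: le_trans (leeD hA hB) _.
rewrite addeACA -EFinD.
have -> : (e / 2 + e / 2 = e)%R by field.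
exact: leeD.
Qed.
End real_line.

(** * Layers of a nonnegative function *)

Section layer_cake.
Context d (T : measurableType d) {R : realType}.
Variable m : {sigma_finite_measure set T -> \bar R}.
Local Open Scope ereal_scope.
Local Notation mu := (@lebesgue_measure R).

Variables (phi : T -> \bar R) (M : R).
Hypotheses (mphi : measurable_fun [set: T] phi) (phi0 : forall x, 0 <= phi x).
Hypothesis M0 : (0 < M)%R.

Let hypograph : set (measurableTypeR R * T) :=
  [set p | (p.1 * M)%:E <= phi p.2].

Let measurable_hypograph : measurable hypograph.
Proof.
rewrite -[hypograph]setTI; apply: measurable_lee => //.
- apply/measurable_EFinP.
  by apply: measurable_funM.
- exact: measurableT_comp.
Qed.

Lemma measurable_fun_level :
  measurable_fun [set: measurableTypeR R]
    (fun s : R => m [set x | (s * M)%:E <= phi x]).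
Proof.
have := measurable_fun_xsection m measurable_hypograph.
apply: eq_measurable_fun => s _ /=; congr (m _).
by apply/seteqP; split => x /=; rewrite /xsection /= inE.
Qed.

(** Both sides compute, up to the factor [M], the area of the region
    $0 < s < 1$, $s M \le \varphi(x)$. *)
Lemma layer_cake :
  M%:E * \int[mu]_(s in `]0%R, 1%R[) m [set x | (s * M)%:E <= phi x]
  = \int[m]_x mine (phi x) M%:E.
Proof.
pose E := hypograph `&` (fst @^-1` `]0%R, 1%R[%classic).
have mE : measurable E.
  apply: measurableI => //; rewrite -[X in measurable X]setTI.
  exact: measurable_fst.
have EE : (mu \x m) E = (mu \x^ m) E.
  by apply: product_measure_unique => // A B mA mB; exact: product_measure2E.
have <- : (mu \x m) E
    = \int[mu]_(s in `]0%R, 1%R[) m [set x | (s * M)%:E <= phi x].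
  rewrite [RHS]integral_mkcond; apply: eq_integral => s _ /=.
  rewrite patchE; case: ifPn => [|]; rewrite ?notin_setE ?inE => hs.
    by congr (m _); apply/seteqP; split => x /=; rewrite /xsection /= inE => // -[].
  rewrite [X in m X](_ : _ = set0) ?measure0// -subset0 => x.
  by rewrite /xsection /= inE => -[].
rewrite EE /product_measure2 -ge0_integralZl//; last 2 first.
- exact: measurable_fun_ysection.
- by rewrite lee_fin ltW.
(* The section at [x] has length $\min(\varphi(x) / M, 1)$. *)
apply: eq_integral => x _ /=.
have sE : ysection E x = [set s | (s * M)%:E <= phi x] `&` `]0%R, 1%R[.
  by apply/seteqP; split => s /=; rewrite /ysection /= inE.
have full : M%:E <= phi x -> M%:E * mu (ysection E x) = M%:E.
  move=> h; rewrite sE setIidr; last first.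
    move=> s /=; rewrite in_itv /= => /andP[s0 s1]; apply: le_trans h.
    by rewrite lee_fin ler_piMl // ltW.
  by rewrite lebesgue_measure_itv /= lte_fin ltr01 -EFinB subr0 mule1.
have [h|h] := leP M%:E (phi x); first by rewrite full.
have := phi0 x; case: (phi x) h sE {full} => [t| |] //=.
rewrite lte_fin lee_fin => h sE t0.
rewrite sE (_ : _ `&` _ = `]0%R, (t / M)%R]%classic).
  rewrite lebesgue_measure_itv /= lte_fin; case: ifPn => [_|].
    by rewrite -EFinB subr0 -EFinM mulrC divfK // gt_eqF.
  rewrite -leNgt pmulr_lle0 ?invr_gt0 // => t_le0.
  by rewrite mule0; congr (_%:E); apply/eqP; rewrite eq_le t0.
apply/seteqP; split => s /=; rewrite !in_itv /= lee_fin ler_pdivlMr //.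
  by move=> [-> /andP[-> _]].
move=> /andP[s0 sM]; split => //; rewrite s0 /=.
by rewrite -(ltr_pM2r M0) mul1r; apply: le_lt_trans h.
Qed.

End layer_cake.

(** * Radon's inequality *)

Section radon.
Context {R : realFieldType}.

(** Convexity of the power function in tangent form. Multiplying the bound for
    [n] by [u] overshoots the bound for [n.+1] by $(n + 1) w^n (u - w)^2$. *)
Lemma exprS_tangent (n : nat) (u w : R) : 0 <= u -> 0 <= w ->
  w ^+ n.+1 + n.+1%:R * w ^+ n * (u - w) <= u ^+ n.+1.
Proof.
move=> u0 w0; elim: n => [|n IH]; first by rewrite !expr1 expr0; lra.
have := ler_wpM2l u0 IH; rewrite -exprS; apply: le_trans.
rewrite -subr_ge0.
rewrite (_ : _ - _ = w ^+ n * n.+1%:R * (u - w) ^+ 2); last first.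
  by rewrite !exprS -![in n.+2%:R]natr1 -natr1; ring.
by rewrite mulr_ge0 ?sqr_ge0 // mulr_ge0 // exprn_ge0.
Qed.

(** With weights $p / (p + q)$ and $q / (p + q)$ this is Jensen's inequality for
    $u \mapsto u^{n + 1}$ at the points $a / p$ and $b / q$: their mean is
    $w = (a + b) / (p + q)$, so the linear terms of the tangent at $w$ cancel. *)
Lemma radon_inequality (n : nat) (a b p q : R) :
  0 <= a -> 0 <= b -> 0 < p -> 0 < q ->
  (a + b) ^+ n.+1 / (p + q) ^+ n <= a ^+ n.+1 / p ^+ n + b ^+ n.+1 / q ^+ n.
Proof.
move=> a0 b0 p0 q0.
have pq0 : 0 < p + q by rewrite addr_gt0.
have scale (c t : R) : 0 < t -> c ^+ n.+1 / t ^+ n = t * (c / t) ^+ n.+1.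
  move=> t0; have t_neq0 : t != 0 by rewrite gt_eqF.
  rewrite expr_div_n [t ^+ n.+1]exprS; field.
  by rewrite t_neq0 expf_neq0.
rewrite !scale //.
set w := (a + b) / (p + q).
have w0 : 0 <= w by rewrite divr_ge0 ?addr_ge0 // ltW.
have hu := ler_wpM2l (ltW p0) (exprS_tangent n (divr_ge0 a0 (ltW p0)) w0).
have hv := ler_wpM2l (ltW q0) (exprS_tangent n (divr_ge0 b0 (ltW q0)) w0).
apply: le_trans (lerD hu hv); rewrite -subr_ge0.
rewrite (_ : _ - _ = n.+1%:R * w ^+ n *
   (p * (a / p) + q * (b / q) - (p + q) * w)); last by ring.
rewrite /w ![_ * (_ / _)]mulrC !divfK ?gt_eqF //.
by rewrite subrr mulr0.
Qed.

End radon.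

(** * Slices and translates in the product space *)

Section euclidean_volume.
Context {R : realType}.
Local Open Scope ereal_scope.
Local Notation mu := (@lebesgue_measure R).
Local Notation point n := (n.-tuple (measurableTypeR R)).
Local Notation vol n := (power_measure mu n).

Definition slice n (A : set (point n.+1)) (x : R) : set (point n) :=
  [set t | A (tuple_cons (x : measurableTypeR R, t))].

Lemma xsection_slice n (A : set (point n.+1)) x :
  xsection ((@tuple_cons _ (measurableTypeR R) n) @^-1` A) x = slice A x.
Proof. by apply/seteqP; split => t /=; rewrite /xsection /= inE. Qed.

Lemma measurable_tuple_cons_preimage n (A : set (point n.+1)) :
  measurable A -> measurable ((@tuple_cons _ (measurableTypeR R) n) @^-1` A).
Proof.
by move=> mA; rewrite -[X in measurable X]setTI; exact: measurable_tuple_cons.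
Qed.

Lemma measurable_slice n (A : set (point n.+1)) x :
  measurable A -> measurable (slice A x).
Proof.
by move=> /measurable_tuple_cons_preimage/measurable_xsection; rewrite -xsection_slice.
Qed.

Lemma measurable_vol_slice n (A : set (point n.+1)) : measurable A ->
  measurable_fun [set: measurableTypeR R] (fun x : R => vol n (slice A x)).
Proof.
move=> /measurable_tuple_cons_preimage/(measurable_fun_xsection (vol n)).
by apply: eq_measurable_fun => x _ /=; rewrite xsection_slice.
Qed.

(** Cavalieri's principle: the product measure is by definition the integral of
    the measures of the sections. *)
Lemma volS n (A : set (point n.+1)) :
  vol n.+1 A = \int[mu]_x vol n (slice A x).
Proof.
by apply: eq_integral => x _ /=; rewrite xsection_slice.
Qed.

Definition tuple_add n (s t : point n) : point n :=
  [tuple (tnth s i + tnth t i)%R | i < n].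

Lemma tuple_add_cons n (x y : R) (s t : point n) :
  tuple_add (tuple_cons (x : measurableTypeR R, s))
    (tuple_cons (y : measurableTypeR R, t))
  = tuple_cons ((x + y)%R : measurableTypeR R, tuple_add s t).
Proof.
apply: eq_from_tnth => i; rewrite tnth_mktuple.
case: (unliftP ord0 i) => [j|] -> //.
by rewrite /tuple_cons !tnthS tnth_mktuple.
Qed.

Lemma tuple_addC n : commutative (@tuple_add n).
Proof. by move=> s t; apply: eq_from_tnth => i; rewrite !tnth_mktuple addrC. Qed.

Lemma measurable_tuple_add n (v : point n) :
  measurable_fun [set: point n] (tuple_add v).
Proof.
apply/measurable_fun_tnthP => i.
rewrite (_ : _ \o _ = (fun x : R => (tnth v i + x)%R : measurableTypeR R) \o
   (fun t : point n => tnth t i)); last first.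
  by apply/funext => t /=; rewrite tnth_mktuple.
apply: measurableT_comp; first exact: measurable_shift.
exact: measurable_tnth.
Qed.

Lemma measurable_tuple_add_preimage n (v : point n) (A : set (point n)) :
  measurable A -> measurable [set t | A (tuple_add v t)].
Proof.
by move=> mA; rewrite -[X in measurable X]setTI; exact: measurable_tuple_add.
Qed.

Lemma tuple_consP n (v : point n.+1) :
  exists x t, v = tuple_cons (x : measurableTypeR R, t).
Proof.
exists (thead v), [tuple of behead v].
by rewrite [LHS]tuple_eta; apply: val_inj.
Qed.

Definition bounded_by n (r : R) (A : set (point n)) :=
  forall t, A t -> forall i, (`|tnth t i| <= r)%R.

Lemma bounded_by_slice n r (A : set (point n.+1)) x :
  bounded_by r A -> bounded_by r (slice A x).
Proof. by move=> Ar t /Ar tr i; have := tr (lift ord0 i); rewrite /tuple_cons tnthS. Qed.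

Lemma bounded_by_base n r (A : set (point n.+1)) x :
  bounded_by r A -> slice A x !=set0 -> (`|x| <= r)%R.
Proof. by move=> Ar [t /Ar/(_ ord0)]. Qed.

Lemma vol_gt0_nonempty n (A : set (point n)) : 0 < vol n A -> A !=set0.
Proof.
by have [->|/set0P//] := eqVneq A set0; rewrite measure0 ltxx.
Qed.

Lemma vol_bounded n r : exists K : R, forall A : set (point n),
  measurable A -> bounded_by r A -> vol n A <= K%:E.
Proof.
elim: n => [|n [K IH]].
  exists 1%R => A mA _ /=; rewrite diracE lee_fin.
  by case: (_ \in _).
pose K' := Num.max K 0%R.
exists (fine (K'%:E * mu `[(- r)%R, r]%classic)) => A mA Ar.
have K'0 : (0 <= K')%R by rewrite le_max lexx orbT.
rewrite volS fineK; last first.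
  rewrite fin_numM // lebesgue_measure_itv /=; by case: ifP.
apply: (@le_trans _ _ (\int[mu]_x (K'%:E * (\1_(`[(- r)%R, r]%classic : set R) x)%:E))).
  apply: ge0_le_integral => //.
  - exact: measurable_vol_slice.
  - by apply: measurable_funeM; apply/measurable_EFinP; exact: measurable_indic.
  move=> x _; have [->|/set0P[t st]] := eqVneq (slice A x) set0.
    by rewrite measure0 mule_ge0 // lee_fin.
  rewrite indicE mem_set; last first.
    by rewrite /= in_itv /= -ler_norml (bounded_by_base Ar)//; exists t.
  rewrite mule1 (le_trans (IH _ _ _)) //.
  - exact: measurable_slice.
  - exact: bounded_by_slice.
  by rewrite lee_fin le_max lexx.
rewrite ge0_integralZl//; last first.
  by apply/measurable_EFinP; exact: measurable_indic.
by rewrite integral_indic // setIT.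
Qed.

(** Translation in the first coordinate permutes the slices and preserves the
    outer integral; in the other coordinates it translates each slice. *)
Lemma vol_translate n (v : point n) (A : set (point n)) : measurable A ->
  vol n [set t | A (tuple_add v t)] = vol n A.
Proof.
elim: n v A => [|n IH] v A mA.
  congr (vol 0 _); apply/seteqP.
  by split => t /=; rewrite [tuple_add v t]tuple0 [t]tuple0.
have [x [w ->]] := tuple_consP v.
rewrite !volS.
transitivity (\int[mu]_y vol n (slice A (x + y)%R)).
  apply: eq_integral => y _.
  rewrite -[RHS](IH w); last exact: measurable_slice.
  by congr (vol n _); apply/seteqP; split => t; rewrite /slice /= tuple_add_cons.
have mx := measurable_shift x.
rewrite -(@ge0_integral_pushforward _ _ (measurableTypeR R) (measurableTypeR R) R
  _ mx mu setT (fun y => vol n (slice A y))) //=.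
  apply: eq_measure_integral => //= B mB _.
  by rewrite /pushforward lebesgue_measure_shift.
exact: measurable_vol_slice.
Qed.

End euclidean_volume.

(** * Brunn-Minkowski in every dimension *)

Section brunn_minkowski.
Context {R : realType}.
Local Open Scope ereal_scope.
Local Notation mu := (@lebesgue_measure R).
Local Notation point n := (n.-tuple (measurableTypeR R)).
Local Notation vol n := (power_measure mu n).

(** The largest slice volume is recorded as an $n$-th power [c ^+ n], the form
    that the induction on the dimension consumes. It need not be attained, hence
    the factor [s]. *)
Lemma sup_vol_slice n (A : set (point n.+1)) (r : R) :
  measurable A -> bounded_by r A -> 0 < vol n.+1 A ->
  exists c : R, [/\ (0 < c)%R,
    forall x, vol n (slice A x) <= (c ^+ n)%:E &
    forall s : R, (0 < s < 1)%R ->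
      exists x, (s * c ^+ n)%:E <= vol n (slice A x)].
Proof.
move=> mA Ar A0.
have [x0 px0] : exists x, 0 < vol n (slice A x).
  apply: contrapT => /forallNP h; move: A0.
  rewrite volS integral0_eq ?ltxx // => x _.
  by apply/eqP; rewrite eq_le measure_ge0 andbT leNgt; apply/negP.
case: n => [|n] in A mA Ar A0 x0 px0 *.
  (* A slice of dimension zero has volume 0 or 1. *)
  exists 1%R; split => //.
    by move=> x; rewrite /= diracE expr0 lee_fin; case: (_ \in _).
  move=> s /andP[s0 s1]; exists x0; move: px0 => /=.
  by rewrite !diracE mulr1; case: (_ \in _); rewrite ?ltxx // lee_fin ltW.
have [K HK] := vol_bounded n.+1 r.
have sliceK x : vol n.+1 (slice A x) <= K%:E.
  by apply: HK; [exact: measurable_slice | exact: bounded_by_slice].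
have fin x : vol n.+1 (slice A x) \is a fin_num.
  by rewrite ge0_fin_numE // (le_lt_trans (sliceK x)) ?ltry.
pose S := range (fun x => fine (vol n.+1 (slice A x))).
have supS : has_sup S.
  split; first by exists (fine (vol n.+1 (slice A x0))); exists x0.
  by exists K => _ [x _ <-]; rewrite -lee_fin fineK.
have leS x : (fine (vol n.+1 (slice A x)) <= sup S)%R.
  by apply: ub_le_sup; [case: supS | exists x].
have M0 : (0 < sup S)%R.
  by apply: lt_le_trans (leS x0); rewrite -lte_fin fineK.
have cE : ((sup S `^ n.+1%:R^-1) ^+ n.+1)%R = sup S.
  by rewrite -powR_mulrn ?powR_ge0 // -powRrM mulVf // powRr1 // ltW.
exists (sup S `^ n.+1%:R^-1)%R; split; rewrite ?powR_gt0 //.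
  by move=> x; rewrite cE -[X in X <= _]fineK // lee_fin.
move=> s /andP[s0 s1]; rewrite cE.
have e0 : (0 < (1 - s) * sup S)%R by rewrite mulr_gt0 // subr_gt0.
have [_ [x _ <-] hx] := sup_adherent e0 supS.
exists x; rewrite -[X in _ <= X]fineK // lee_fin ltW //.
by apply: le_lt_trans hx; lra.
Qed.

(** Volumes are compared with $n$-th powers, so that no $n$-th root appears and
    the induction can start in dimension zero. For $n \ge 1$ the factor [s] can
    be absorbed into [a] and [b]; in dimension zero it cannot, and the induction
    step needs the statement for slices at every level $0 < s < 1$. *)
Lemma brunn_minkowski n (A B C : set (point n)) (r s a b : R) :
  measurable A -> measurable B -> measurable C ->
  bounded_by r A -> bounded_by r B -> A !=set0 -> B !=set0 ->
  (forall t u, A t -> B u -> C (tuple_add t u)) ->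
  (0 < s)%R -> (0 <= a)%R -> (0 <= b)%R ->
  (s * a ^+ n)%:E <= vol n A -> (s * b ^+ n)%:E <= vol n B ->
  (s * (a + b) ^+ n)%:E <= vol n C.
Proof.
elim: n A B C s a b => [|n IH] A B C s a b mA mB mC Ar Br A0 B0 ABC s0 a0 b0 hA hB.
  apply: le_trans hA _; apply: le_measure; rewrite ?inE // => t _.
  have [u Au] := A0; have [v Bv] := B0.
  by rewrite tuple0 -(tuple0 (tuple_add u v)); exact: ABC.
have null (c : R) : (0 <= c)%R -> (s * c ^+ n.+1)%:E <= 0 -> c = 0%R.
  move=> c0; rewrite lee_fin pmulr_rle0 // => h.
  have : (c ^+ n.+1 == 0)%R by rewrite eq_le h exprn_ge0.
  by rewrite expf_eq0 => /eqP.
(* If one set is null, the other one has a translate inside [C]. *)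
have [vA|vA] := leP (vol n.+1 A) 0.
  rewrite (null a) ?(le_trans hA) // add0r (le_trans hB)//.
  have [t At] := A0; rewrite -(vol_translate t mC).
  apply: le_measure; rewrite ?inE //; last by move=> u Bu /=; exact: ABC.
  exact: measurable_tuple_add_preimage.
have [vB|vB] := leP (vol n.+1 B) 0.
  rewrite (null b) ?(le_trans hB) // addr0 (le_trans hA)//.
  have [u Bu] := B0; rewrite -(vol_translate u mC).
  apply: le_measure; rewrite ?inE //; last first.
    by move=> t At /=; rewrite tuple_addC; exact: ABC.
  exact: measurable_tuple_add_preimage.
have [p [p0 Ap pA]] := sup_vol_slice mA Ar vA.
have [q [q0 Bq qB]] := sup_vol_slice mB Br vB.
have pq0 : (0 < p + q)%R by rewrite addr_gt0.
(* [level D c] is the mean length, over heights $0 < v < 1$, of the set of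
   slices of [D] of volume at least [v * c ^+ n]. *)
pose level (D : set (point n.+1)) (c : R) :=
  \int[mu]_(v in `]0%R, 1%R[) mu [set x | (v * c ^+ n)%:E <= vol n (slice D x)].
have mlevel (D : set (point n.+1)) (c : R) : measurable D ->
    measurable_fun (`]0%R, 1%R[%classic : set (measurableTypeR R))
    (fun v : R => mu [set x | (v * c ^+ n)%:E <= vol n (slice D x)]).
  move=> mD; apply: measurable_funTS; apply: measurable_fun_level => //.
  exact: measurable_vol_slice.
have levelE (D : set (point n.+1)) (c : R) : measurable D -> (0 < c)%R ->
    (c ^+ n)%:E * level D c = \int[mu]_x mine (vol n (slice D x)) (c ^+ n)%:E.
  move=> mD c0; apply: layer_cake => //; first exact: measurable_vol_slice.
  exact: exprn_gt0.
have levelA : vol n.+1 A = (p ^+ n)%:E * level A p.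
  by rewrite levelE // volS; apply: eq_integral => x _; rewrite min_l.
have levelB : vol n.+1 B = (q ^+ n)%:E * level B q.
  by rewrite levelE // volS; apply: eq_integral => x _; rewrite min_l.
have levelC : ((p + q) ^+ n)%:E * level C (p + q)%R <= vol n.+1 C.
  rewrite levelE // volS; apply: ge0_le_integral => //.
  - by move=> x _; rewrite le_min measure_ge0 lee_fin exprn_ge0 // ltW.
  - by apply: measurable_mine => //; exact: measurable_vol_slice.
  - exact: measurable_vol_slice.
  by move=> x _; rewrite ge_min lexx.
have levelABC : level A p + level B q <= level C (p + q)%R.
  (* At each height, apply the inequality on the line to the base sets, and
     the induction hypothesis to the slices over them. *)
  rewrite /level -ge0_integralD //; try exact: mlevel.
  apply: ge0_le_integral => //.
  - by move=> v _; exact: adde_ge0.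
  - by apply: emeasurable_funD; exact: mlevel.
  - exact: mlevel.
  move=> v /=; rewrite in_itv /= => v01; have /andP[v0 v1] := v01.
  have mset (D : set (point n.+1)) (c : R) : measurable D -> measurable
      ([set x : R | (v * c ^+ n)%:E <= vol n (slice D x)] :
        set (measurableTypeR R)).
    move=> mD; rewrite -[X in measurable X]setTI; apply: measurable_lee => //.
    exact: measurable_vol_slice.
  have ne (D : set (point n.+1)) (c x : R) : (0 < c)%R ->
      (v * c ^+ n)%:E <= vol n (slice D x) -> slice D x !=set0.
    move=> c0 h; apply: vol_gt0_nonempty; apply: lt_le_trans h.
    by rewrite lte_fin mulr_gt0 // exprn_gt0.
  apply: (@brunn_minkowski1 _ _ _ _ r) => //; try exact: mset.
  - exact: pA.
  - exact: qB.
  - by move=> x /= hx; apply: (bounded_by_base Ar); exact: ne hx.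
  - by move=> x /= hx; apply: (bounded_by_base Br); exact: ne hx.
  move=> x y /= hx hy.
  apply: (IH (slice A x) (slice B y)) => //;
    try exact: measurable_slice; try exact: bounded_by_slice.
  - exact: ne hx.
  - exact: ne hy.
  - by move=> t u At Bu; rewrite /slice /= -tuple_add_cons; exact: ABC.
  - exact: ltW.
  - exact: ltW.
have level_ge (D : set (point n.+1)) (c d : R) : (0 < c)%R ->
    vol n.+1 D = (c ^+ n)%:E * level D c ->
    (s * d ^+ n.+1)%:E <= vol n.+1 D ->
    (s * (d ^+ n.+1 / c ^+ n))%:E <= level D c.
  move=> c0 -> h.
  by rewrite mulrA EFinM lee_pdivrMr ?exprn_gt0 // muleC.
apply: le_trans levelC.
apply: (@le_trans _ _ (((p + q) ^+ n)%:E *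
    (s * (a ^+ n.+1 / p ^+ n + b ^+ n.+1 / q ^+ n))%:E)).
  rewrite -EFinM lee_fin mulrCA ler_wpM2l ?(ltW s0) //.
  rewrite mulrC -ler_pdivrMr ?exprn_gt0 //.
  exact: radon_inequality.
rewrite lee_wpmul2l ?lee_fin ?exprn_ge0 ?(ltW pq0) //.
apply: le_trans levelABC; rewrite mulrDr EFinD.
by apply: leeD; apply: level_ge.
Qed.
End brunn_minkowski.

(** * Euclidean norm, and volumes of closed sets *)

Section euclidean_norm.
Context {R : realType} {n : nat}.
Implicit Types x y : 'rV[R]_n.

Lemma enorm_ge0 x : 0 <= enorm x.
Proof. exact: sqrtr_ge0. Qed.

Lemma sumsq_ge0 x : 0 <= \sum_i x ord0 i ^+ 2.
Proof. by apply: sumr_ge0 => i _; exact: sqr_ge0. Qed.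

Lemma enorm_sqr x : enorm x ^+ 2 = \sum_i x ord0 i ^+ 2.
Proof. by rewrite sqr_sqrtr // sumsq_ge0. Qed.

Lemma enormZ (a : R) x : 0 <= a -> enorm (a *: x) = a * enorm x.
Proof.
move=> a0; rewrite /enorm.
under eq_bigr do rewrite mxE exprMn.
by rewrite -mulr_sumr sqrtrM ?sqr_ge0 // sqrtr_sqr ger0_norm.
Qed.

Lemma enorm0 : enorm (0 : 'rV[R]_n) = 0.
Proof. by rewrite -(scale0r (0 : 'rV[R]_n)) enormZ // mul0r. Qed.

Lemma coord_le_enorm x i : `|x ord0 i| <= enorm x.
Proof.
rewrite -sqrtr_sqr ler_sqrt ?sumsq_ge0 // (bigD1 i) //= lerDl.
by apply: sumr_ge0 => j _; exact: sqr_ge0.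
Qed.

Lemma enorm_eq0 x : enorm x <= 0 -> x = 0.
Proof.
move=> x0; apply/rowP => i; rewrite mxE; apply/eqP.
by rewrite -normr_le0 (le_trans (coord_le_enorm x i)).
Qed.

Lemma cauchy_schwarz x y :
  \sum_i x ord0 i * y ord0 i <= enorm x * enorm y.
Proof.
set p := enorm x; set q := enorm y.
have [p0|p0] := leP p 0.
  rewrite big1 ?mulr_ge0 ?enorm_ge0 // => i _.
  by rewrite (enorm_eq0 p0) mxE mul0r.
have [q0|q0] := leP q 0.
  rewrite big1 ?mulr_ge0 ?enorm_ge0 // => i _.
  by rewrite (enorm_eq0 q0) mxE mulr0.
have : 0 <= \sum_i (q * x ord0 i - p * y ord0 i) ^+ 2.
  by apply: sumr_ge0 => i _; exact: sqr_ge0.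
have -> : \sum_i (q * x ord0 i - p * y ord0 i) ^+ 2 =
    q ^+ 2 * \sum_i x ord0 i ^+ 2 + p ^+ 2 * \sum_i y ord0 i ^+ 2
    - 2 * (p * q) * \sum_i x ord0 i * y ord0 i.
  rewrite !mulr_sumr -big_split -sumrB /=; apply: eq_bigr => i _; ring.
rewrite -!enorm_sqr -/p -/q.
rewrite (_ : _ - _ = 2 * (p * q) * (p * q - \sum_i x ord0 i * y ord0 i)); last by ring.
by rewrite pmulr_rge0 ?subr_ge0 // !mulr_gt0.
Qed.

Lemma ler_enormD x y : enorm (x + y) <= enorm x + enorm y.
Proof.
rewrite -(ler_pXn2r (n := 2)) ?nnegrE ?addr_ge0 ?enorm_ge0 //.
rewrite sqrrD !enorm_sqr.
under eq_bigr do rewrite mxE sqrrD.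
rewrite !big_split /= lerD2r lerD2l mulr2n.
by apply: lerD; exact: cauchy_schwarz.
Qed.

Lemma continuous_enorm : continuous (@enorm R n).
Proof.
move=> x; apply: continuous_comp; last exact: sqrt_continuous.
apply: (@continuous_big R _ +%R 0 predT _ 'rV[R]_n _
  (fun i (z : 'rV[R]_n) => z ord0 i ^+ 2)) => [|i _ z].
  exact: add_continuous.
apply: (@continuous_comp _ _ _ (fun z : 'rV[R]_n => z ord0 i) (fun t => t ^+ 2)).
  exact: coord_continuous.
exact: exprn_continuous.
Qed.

(** A ball of radius zero needs separate care: scaling by zero must still give
    exactly the origin. *)
Lemma ball_rearrangementE (K : set 'rV[R]_n) :
  ball_rearrangement K =
  [set x | enorm x <= (fine (Vol K) / fine (Vol (@unit_ball R n))) `^ n%:R^-1].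
Proof.
rewrite /ball_rearrangement; set r := _ `^ _.
have r0 : 0 <= r := powR_ge0 _ _.
apply/seteqP; split => [_ [x x1 <-]|x /= xr] /=.
  by rewrite enormZ // ler_piMr.
have [r_gt0|r_le0] := ltP 0 r.
  exists (r^-1 *: x); last by rewrite scalerA divff ?scale1r // gt_eqF.
  by rewrite /unit_ball /= enormZ ?invr_ge0 // mulrC ler_pdivrMr // mul1r.
exists 0; first by rewrite /unit_ball /= enorm0.
by rewrite scaler0 (enorm_eq0 (le_trans xr r_le0)).
Qed.

End euclidean_norm.

Section borel_volume.
Context {R : realType}.
Local Notation point n := (n.-tuple (measurableTypeR R)).

Definition row_of_tuple n (t : point n) : 'rV[R]_n := \row_i tnth t i.

Lemma row_of_tuple_add n (s t : point n) :
  row_of_tuple (tuple_add s t) = row_of_tuple s + row_of_tuple t.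
Proof. by apply/rowP => i; rewrite !mxE tnth_mktuple. Qed.

Lemma row_of_tuple_surj n (x : 'rV[R]_n) : exists t : point n, row_of_tuple t = x.
Proof.
exists [tuple x ord0 i | i < n].
by apply/rowP => i; rewrite mxE tnth_mktuple.
Qed.

(** An open set is the union of the countably many cubes with rational center
    and radius $1 / (k + 1)$ that it contains. *)
Lemma measurable_open_preimage n (U : set 'rV[R]_n) : open U ->
  measurable [set t : point n | U (row_of_tuple t)].
Proof.
move=> oU.
pose radius k : R := k.+1%:R^-1.
pose center (c : n.-tuple rat) : 'rV[R]_n := \row_i ratr (tnth c i).
pose box (p : n.-tuple rat * nat) : set (point n) :=
  [set t | ball (center p.1) (radius p.2) `<=` U /\
     forall i, `|ratr (tnth p.1 i) - tnth t i| < radius p.2].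
have -> : [set t : point n | U (row_of_tuple t)] = \bigcup_p box p.
  apply/seteqP; split => [t /= Ut|t [[c k] _ [cU tc]]]; last first.
    apply: cU; split => [|i j]; first by rewrite invr_gt0.
    by rewrite !mxE; exact: tc.
  have /nbhs_ballP[e /= e0 eU] := open_nbhs_nbhs (conj oU Ut).
  (* A cube of radius below [e / 2] that contains [t] stays within [e] of it. *)
  have e20 : 0 < e / 2 by rewrite divr_gt0.
  have [k _ /(_ k (leqnn k)) /= ke] := near_infty_natSinv_lt (PosNum e20).
  have r0 : 0 < radius k by rewrite invr_gt0.
  have q i : {q : rat | ratr q \in `](tnth t i - radius k), (tnth t i + radius k)[}.
    by apply/cid/rat_in_itvoo; lra.
  pose c := [tuple sval (q i) | i < n].
  have ct i : `|ratr (tnth c i) - tnth t i| < radius k.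
    rewrite tnth_mktuple; have := svalP (q i); rewrite in_itv /= => /andP[? ?].
    by rewrite ltr_norml; apply/andP; split; lra.
  exists (c, k) => //; split => //= y [_ cy]; apply: eU; split => // i j.
  rewrite (ord1 i) mxE; change (`|tnth t j - y ord0 j| < e).
  rewrite -[_ - _](subrKA (ratr (tnth c j))).
  have cyj : `|ratr (tnth c j) - y ord0 j| < radius k.
    by have := cy ord0 j; rewrite mxE.
  apply: le_lt_trans (ler_normD _ _) _.
  have := ct j; rewrite distrC => ctj.
  have kE : radius k < e / 2 := ke.
  lra.
apply: countable_bigcupT_measurable; first exact: countableP.
move=> [c k]; have [cU|cU] := pselect (ball (center c) (radius k) `<=` U); last first.
  by rewrite (_ : box _ = set0) // -subset0 => t [].
rewrite (_ : box _ = \bigcap_(i in [set: 'I_n])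
    (fun t : point n => tnth t i) @^-1` ball (ratr (tnth c i) : R) (radius k)).
  apply: fin_bigcap_measurable => // i _; rewrite -[X in measurable X]setTI.
  by apply: measurable_tnth => //; exact: measurable_ball.
by apply/seteqP; split => [t [_ h] i _|t h]; [exact: h|split => // i; exact: h].
Qed.

Lemma measurable_closed_preimage n (K : set 'rV[R]_n) : closed K ->
  measurable [set t : point n | K (row_of_tuple t)].
Proof.
move=> cK; rewrite -[X in measurable X]setCK; apply: measurableC.
by apply: (@measurable_open_preimage n (~` K)); exact: closed_openC.
Qed.

End borel_volume.

(** * Existence of rearrangements *)

Section existence_of_rearrangement.
Context {R : realType} {n : nat}.
Hypothesis n_gt0 : (0 < n)%N.
Local Notation Rn := 'rV[R]_n.
Implicit Types (K : set Rn) (x y : Rn).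

Definition equiradius K : R :=
  (fine (Vol K) / fine (Vol (@unit_ball R n))) `^ n%:R^-1.

Lemma equiradius_ge0 K : 0 <= equiradius K.
Proof. exact: powR_ge0. Qed.

Lemma fine_Vol_ge0 K : 0 <= fine (Vol K).
Proof. exact/fine_ge0/measure_ge0. Qed.

Lemma powR_rootK (a : R) : 0 <= a -> (a `^ n%:R^-1) ^+ n = a.
Proof.
move=> a0; rewrite -powR_mulrn ?powR_ge0 // -powRrM mulVf ?powRr1 //.
by rewrite pnatr_eq0 -lt0n.
Qed.

Lemma le_equiradius K (e : R) : 0 <= e ->
  (e <= equiradius K) = (e ^+ n <= fine (Vol K) / fine (Vol (@unit_ball R n))).
Proof.
move=> e0; rewrite -[in RHS](@powR_rootK (_ / _)) ?divr_ge0 ?fine_Vol_ge0 //.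
by rewrite ler_pXn2r // nnegrE equiradius_ge0.
Qed.

Definition coord_bounded K :=
  exists r : R, forall x, K x -> forall i, `|x ord0 i| <= r.

Lemma Vol_fin_num K : closed K -> coord_bounded K -> Vol K \is a fin_num.
Proof.
move=> cK [r Kr]; have [M HM] := @vol_bounded R n r.
rewrite ge0_fin_numE ?measure_ge0 //.
apply: (@le_lt_trans _ _ M%:E); last exact: ltry.
apply: HM; first exact: measurable_closed_preimage.
by move=> t /= Kt i; have := Kr _ Kt i; rewrite mxE.
Qed.

Lemma le_Vol K L : closed K -> closed L -> K `<=` L -> (Vol K <= Vol L)%E.
Proof.
move=> cK cL KL; apply: le_measure; rewrite ?inE; last by move=> t; exact: KL.
- exact: (measurable_closed_preimage cK).
- exact: (measurable_closed_preimage cL).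
Qed.

Lemma le_equiradius_sub K L : closed K -> closed L ->
  coord_bounded K -> coord_bounded L ->
  K `<=` L -> equiradius K <= equiradius L.
Proof.
move=> cK cL bK bL KL; rewrite le_equiradius ?equiradius_ge0 //.
rewrite powR_rootK ?divr_ge0 ?fine_Vol_ge0 //.
by rewrite ler_wpM2r ?invr_ge0 ?fine_Vol_ge0 // fine_le ?Vol_fin_num // le_Vol.
Qed.

Variable F : Rn -> R.
Hypothesis closedF : forall t : R, 0 < t -> closed (superlevel t F).
Hypothesis boundedF : forall t : R, 0 < t -> coord_bounded (superlevel t F).

Local Notation radius t := (equiradius (superlevel t F)).

Lemma radius_antitone (s t : R) : 0 < s -> s <= t -> radius t <= radius s.
Proof.
move=> s0 st; have t0 := lt_le_trans s0 st.
apply: le_equiradius_sub; try exact: closedF; try exact: boundedF.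
by move=> x; exact: le_trans.
Qed.

(** The sets $K_s$ with $s < t$ decrease to $K_t$, so continuity of the measure
    from above applies. *)
Lemma radius_left_continuous (t e : R) : 0 < t -> 0 <= e ->
  (forall s, 0 < s < t -> e <= radius s) -> e <= radius t.
Proof.
move=> t0 e0 h.
have [c0|c0] := ltP 0 (fine (Vol (@unit_ball R n))); last first.
  (* Division by zero makes all radii equal in this case. *)
  have c_eq0 : fine (Vol (@unit_ball R n)) = 0.
    by apply/eqP; rewrite eq_le c0 fine_Vol_ge0.
  have := h (t / 2); rewrite /equiradius c_eq0 invr0 !mulr0; apply.
  by apply/andP; split; lra.
rewrite le_equiradius // ler_pdivlMr //.
pose u k := t * (1 - k.+2%:R^-1).
have u_itv k : 0 < u k < t.
  have k0 : 0 < k.+2%:R^-1 :> R by rewrite invr_gt0.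
  have k1 : k.+2%:R^-1 < 1 :> R by rewrite invf_lt1 // ltr1n.
  by rewrite /u mulr_gt0 ?subr_gt0 //= gtr_pMr // ltrBlDr ltrDl.
have u0 k : 0 < u k by case/andP: (u_itv k).
pose G k := [set s | superlevel (u k) F (@row_of_tuple R n s)].
have mG k : measurable (G k) by apply: (@measurable_closed_preimage R n); exact: closedF.
have GE : \bigcap_k G k = [set s | superlevel t F (@row_of_tuple R n s)].
  apply/seteqP; split => [s Gs|s ts k _]; last first.
    by apply: le_trans ts; case/andP: (u_itv k) => _ /ltW.
  rewrite /superlevel /= leNgt; apply/negP => Ft.
  have d0 : 0 < (t - F (row_of_tuple s)) / t by rewrite divr_gt0 // subr_gt0.
  have [k _ /(_ k (leqnn k)) /= kd] := near_infty_natSinv_lt (PosNum d0).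
  have := Gs k I; rewrite /G /superlevel /= /u.
  have : k.+2%:R^-1 < (t - F (row_of_tuple s)) / t.
    by apply: le_lt_trans kd; rewrite lef_pV2 ?posrE // ler_nat.
  rewrite ltr_pdivlMr //; move: (_^-1) => w wt; rewrite mulrBr mulr1; lra.
have cvg : (power_measure (@lebesgue_measure R) n \o G) k @[k --> \oo]
    --> Vol (superlevel t F).
  rewrite /Vol -GE; apply: nonincreasing_cvg_mu => //.
  - rewrite -ge0_fin_numE ?measure_ge0 //.
    by apply: Vol_fin_num; [exact: closedF|exact: boundedF].
  - exact: bigcap_measurable.
  move=> i j ij; apply/subsetPset => s; apply: le_trans.
  by rewrite /u ler_pM2l // lerD2l lerN2 lef_pV2 ?posrE // ler_nat.
rewrite -lee_fin fineK; last by apply: Vol_fin_num; [exact: closedF|exact: boundedF].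
apply: cvge_ge cvg; apply: nearW => k /=.
have := h _ (u_itv k); rewrite le_equiradius // ler_pdivlMr // -lee_fin fineK //.
by apply: Vol_fin_num; [exact: closedF|exact: boundedF].
Qed.

(** The layer [0] keeps the supremum nonnegative at points that belong to no
    ball. *)
Definition layered_balls : Rn -> R := fun x =>
  sup ([set 0] `|` [set t | 0 < t <= 1 /\ enorm x <= radius t]).

Let has_sup_layers x :
  has_sup ([set 0] `|` [set t | 0 < t <= 1 /\ enorm x <= radius t]).
Proof.
split; first by exists 0; left.
by exists 1 => t [->|[/andP[]]].
Qed.

Lemma layered_balls_ge0 x : 0 <= layered_balls x.
Proof. by apply: ub_le_sup; [case: (has_sup_layers x)|left]. Qed.

Lemma layered_balls_le1 x : layered_balls x <= 1.
Proof.
apply: ge_sup; first by exists 0; left.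
by move=> t [->|[/andP[]]].
Qed.

(** The supremum of the layers at [x] is itself a layer, by left-continuity of the
    radius. *)
Lemma layered_ballsP (t : R) x : 0 < t -> t <= 1 ->
  (t <= layered_balls x) = (enorm x <= radius t).
Proof.
move=> t0 t1; apply/idP/idP => [tx|xt]; last first.
  by apply: ub_le_sup; [case: (has_sup_layers x)|right; rewrite /= t0].
apply: radius_left_continuous => // [|s /andP[s0 st]]; first exact: enorm_ge0.
have d0 : 0 < t - s by rewrite subr_gt0.
have [s' [->|[/andP[s'0 s'1] xs']]] := sup_adherent d0 (has_sup_layers x).
  rewrite -/(layered_balls x); lra.
rewrite -/(layered_balls x) => hs'.
by apply: le_trans xs' _; apply: radius_antitone => //; lra.
Qed.

Lemma superlevel_layered_balls (t : R) : 0 < t -> t <= 1 ->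
  superlevel t layered_balls = ball_rearrangement (superlevel t F).
Proof.
move=> t0 t1; rewrite ball_rearrangementE.
by apply/seteqP; split => x /=; rewrite /superlevel /= layered_ballsP.
Qed.

Lemma QC_layered_balls : QC layered_balls.
Proof.
split.
- exact: layered_balls_ge0.
- move=> x y l l0 l1; set t := Num.min _ _.
  have [t0|t0] := leP t 0; first exact: le_trans (layered_balls_ge0 _).
  have tx : t <= layered_balls x by rewrite ge_min lexx.
  have ty : t <= layered_balls y by rewrite ge_min lexx orbT.
  have t1 : t <= 1 := le_trans tx (layered_balls_le1 x).
  move: tx ty; rewrite !layered_ballsP // => xt yt.
  apply: le_trans (ler_enormD _ _) _; rewrite !enormZ ?subr_ge0 //.
  rewrite (_ : radius t = l * radius t + (1 - l) * radius t); last by ring.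
  by apply: lerD; apply: ler_wpM2l => //; rewrite subr_ge0.
- move=> x a xa; have a0 := le_lt_trans (layered_balls_ge0 x) xa.
  have [a1|a1] := ltP 1 a.
    by apply: (@nearW _ (nbhs x)) => y; apply: le_lt_trans a1; exact: layered_balls_le1.
  move: xa; rewrite ltNge layered_ballsP // -ltNge => xa.
  have : \forall y \near x, radius a < enorm y.
    exact: (cvgr_gt _ (@continuous_enorm R n x)).
  by apply: filterS => y ay; rewrite ltNge layered_ballsP // -ltNge.
- split; last exact: layered_balls_le1.
  exists 0; apply/eqP; rewrite eq_le layered_balls_le1 /=.
  by rewrite layered_ballsP // enorm0 equiradius_ge0.
- move=> e e0; pose e1 := Num.min e 1.
  have e10 : 0 < e1 by rewrite lt_min e0 ltr01.
  exists (radius e1) => x; rewrite ger0_norm ?layered_balls_ge0 // ltNge.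
  rewrite -layered_ballsP //; last by rewrite ge_min lexx orbT.
  by rewrite -ltNge => /lt_le_trans; apply; rewrite ge_min lexx.
Qed.

Lemma is_rearrangement_rearrangement : is_rearrangement F (rearrangement F).
Proof.
apply: xgetPex; exists layered_balls; split; first exact: QC_layered_balls.
exact: superlevel_layered_balls.
Qed.

End existence_of_rearrangement.

(** * Superlevel sets of the quasi-sum *)

Section quasi_sum.
Context {R : realType} {n : nat}.
Local Notation Rn := 'rV[R]_n.
Implicit Types (f g : Rn -> R) (x y z : Rn).

Lemma closed_superlevel f (t : R) : QC f -> closed (superlevel t f).
Proof.
move=> [_ _ usc _ _]; rewrite -[superlevel _ _]setCK; apply: open_closedC.
rewrite openE => x /=; rewrite /superlevel /= => /negP; rewrite -ltNge => /usc.
by apply: filterS => y yt /=; apply/negP; rewrite -ltNge.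
Qed.

Lemma coord_bounded_superlevel f (t : R) : QC f -> 0 < t ->
  coord_bounded (superlevel t f).
Proof.
move=> [_ _ _ _ vf] t0; have [M HM] := vf t t0; exists M => x xt i.
apply: le_trans (coord_le_enorm x i) _; rewrite leNgt; apply/negP => /HM.
by rewrite ltNge (le_trans xt) // ler_norm.
Qed.

Lemma coord_bounded_closed_compact (K : set Rn) :
  coord_bounded K -> closed K -> compact K.
Proof.
move=> [r Kr] cK; apply: bounded_closed_compact => //.
exists (Num.max r 0); split; first exact: num_real.
move=> M; rewrite gt_max => /andP[rM M0] x /Kr xr.
change (mx_norm x <= M); rewrite mx_normrE; apply/bigmax_leP; split; first exact: ltW.
by move=> [i j] _ /=; rewrite (ord1 i) (le_trans (xr j)) // ltW.
Qed.

Definition minkowski_sum (K L : set Rn) : set Rn :=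
  [set x | exists y z, [/\ K y, L z & y + z = x]].

Lemma closed_minkowski_sum (K L : set Rn) :
  compact K -> compact L -> closed (minkowski_sum K L).
Proof.
move=> cK cL.
rewrite (_ : minkowski_sum K L = (fun p : Rn * Rn => p.1 + p.2) @` (K `*` L)).
  apply: compact_closed; first exact: norm_hausdorff.
  apply: continuous_compact; last exact: compact_setX.
  by apply: continuous_subspaceT; exact: add_continuous.
apply/seteqP; split => [x [y [z [Ky Lz <-]]]|_ [[y z] [Ky Lz] <-]].
  by exists (y, z).
by exists y, z.
Qed.

Lemma coord_bounded_minkowski_sum (K L : set Rn) :
  coord_bounded K -> coord_bounded L -> coord_bounded (minkowski_sum K L).
Proof.
move=> [r Kr] [s Ls]; exists (r + s) => _ [y [z [Ky Lz <-]]] i.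
by rewrite mxE (le_trans (ler_normD _ _)) // lerD ?Kr ?Ls.
Qed.

Variables f g : Rn -> R.
Hypotheses (QCf : QC f) (QCg : QC g).

Let has_sup_quasi_sum x :
  has_sup [set r | exists y z, y + z = x /\ r = Num.min (f y) (g z)].
Proof.
split; first by exists (Num.min (f x) (g 0)), x, 0; rewrite addr0.
have [_ _ _ [_ f1] _] := QCf.
by exists 1 => _ [y [z [_ ->]]]; rewrite ge_min f1.
Qed.

Lemma quasi_sum_ge y z : Num.min (f y) (g z) <= quasi_sum f g (y + z).
Proof. by apply: ub_le_sup; [case: (has_sup_quasi_sum (y + z))|exists y, z]. Qed.

(** The supremum in the quasi-sum is approached from below by its values, whence
    the levels $s < t$. This form makes closedness and boundedness evident
    without showing that the supremum is attained. *)
Lemma superlevel_quasi_sum (t : R) : 0 < t ->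
  superlevel t (quasi_sum f g) = \bigcap_(s in [set s : R | 0 < s < t])
    minkowski_sum (superlevel s f) (superlevel s g).
Proof.
move=> t0; apply/seteqP; split => [x tx s /= /andP[s0 st]|x h].
  have d0 : 0 < t - s by rewrite subr_gt0.
  have [_ [y [z [yzx ->]]]] := sup_adherent d0 (has_sup_quasi_sum x).
  rewrite -/(quasi_sum f g x) => hs.
  have : s <= Num.min (f y) (g z) by move: tx; rewrite /superlevel /=; lra.
  by rewrite le_min => /andP[? ?]; exists y, z.
rewrite /superlevel /= leNgt; apply/negP => xt.
have q0 : 0 <= quasi_sum f g x.
  rewrite -[x]addr0; apply: le_trans (quasi_sum_ge _ _).
  by case: QCf => f0 _ _ _ _; case: QCg => g0 _ _ _ _; rewrite le_min f0 g0.
pose s := (quasi_sum f g x + t) / 2.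
have [|y [z [ys zs yzx]]] := h s; first by rewrite /= /s; apply/andP; split; lra.
have : s <= quasi_sum f g x.
  by rewrite -yzx; apply: le_trans (quasi_sum_ge _ _); rewrite le_min ys zs.
rewrite /s; lra.
Qed.

Lemma closed_superlevel_quasi_sum (t : R) : 0 < t ->
  closed (superlevel t (quasi_sum f g)).
Proof.
move=> t0; rewrite superlevel_quasi_sum //; apply: closed_bigI => s /andP[s0 _].
by apply: closed_minkowski_sum; apply: coord_bounded_closed_compact;
  by [exact: coord_bounded_superlevel | exact: closed_superlevel].
Qed.

Lemma coord_bounded_superlevel_quasi_sum (t : R) : 0 < t ->
  coord_bounded (superlevel t (quasi_sum f g)).
Proof.
move=> t0; have t20 : 0 < t / 2 by rewrite divr_gt0.
have [r hr] := coord_bounded_minkowski_sum (coord_bounded_superlevel QCf t20)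
  (coord_bounded_superlevel QCg t20).
exists r => x; rewrite superlevel_quasi_sum // => /(_ (t / 2)) h.
by apply/hr/h => /=; apply/andP; split; lra.
Qed.

Hypothesis n_gt0 : (0 < n)%N.

(** Brunn-Minkowski for $K_t(f) + K_t(g) \subseteq K_t(f \oplus g)$, with the
    roots of the volumes as [a] and [b]. *)
Lemma equiradius_superadditive (t : R) : 0 < t -> t <= 1 ->
  equiradius (superlevel t f) + equiradius (superlevel t g)
  <= equiradius (superlevel t (quasi_sum f g)).
Proof.
move=> t0 t1.
set K := superlevel t f; set L := superlevel t g; set C := superlevel t _.
have [cK cL cC] : [/\ closed K, closed L & closed C].
  by split; [exact: closed_superlevel|exact: closed_superlevel
    |exact: closed_superlevel_quasi_sum].
have [bK bL bC] : [/\ coord_bounded K, coord_bounded L & coord_bounded C].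
  by split; [exact: coord_bounded_superlevel|exact: coord_bounded_superlevel
    |exact: coord_bounded_superlevel_quasi_sum].
pose a := fine (Vol K) `^ n%:R^-1; pose b := fine (Vol L) `^ n%:R^-1.
have inv0 : 0 <= (fine (Vol (@unit_ball R n)))^-1 by rewrite invr_ge0 fine_Vol_ge0.
have radE (D : set Rn) : equiradius D =
    fine (Vol D) `^ n%:R^-1 * (fine (Vol (@unit_ball R n)))^-1 `^ n%:R^-1.
  by rewrite /equiradius powRM // fine_Vol_ge0.
rewrite !radE -mulrDl ler_wpM2r ?powR_ge0 //.
rewrite -(ler_pXn2r n_gt0) ?nnegrE ?addr_ge0 ?powR_ge0 //.
rewrite [leRHS]powR_rootK ?fine_Vol_ge0 // -lee_fin fineK; last exact: Vol_fin_num.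
rewrite -[X in (X%:E <= _)%E]mul1r.
have [r rK] := bK; have [r' rL] := bL.
have ne (h : Rn -> R) : QC h -> [set s | superlevel t h (@row_of_tuple R n s)] !=set0.
  move=> [_ _ _ [[x hx] _] _]; have [s sx] := row_of_tuple_surj x.
  by exists s; rewrite /= sx /superlevel /= hx.
apply: (@brunn_minkowski R n [set s | K (row_of_tuple s)]
  [set s | L (row_of_tuple s)] _ (Num.max r r') 1) => //.
- exact: measurable_closed_preimage.
- exact: measurable_closed_preimage.
- exact: (measurable_closed_preimage cC).
- by move=> s Ks i; have := rK _ Ks i; rewrite mxE le_max => ->.
- by move=> s Ls i; have := rL _ Ls i; rewrite mxE le_max orbC => ->.
- exact: ne.
- exact: ne.
- move=> u v Ku Lv; rewrite /C /superlevel /=.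
  change (t <= quasi_sum f g (row_of_tuple (tuple_add u v))).
  rewrite row_of_tuple_add.
  by apply: le_trans (quasi_sum_ge _ _); rewrite le_min; apply/andP.
- exact: powR_ge0.
- exact: powR_ge0.
- by rewrite mul1r powR_rootK ?fine_Vol_ge0 // fineK //; exact: Vol_fin_num.
- by rewrite mul1r powR_rootK ?fine_Vol_ge0 // fineK //; exact: Vol_fin_num.
Qed.

End quasi_sum.

(** * The rearrangement inequality *)

Theorem theorem16 (R : realType) (n : nat) (hn : (1 <= n)%N)
    (f g : 'rV[R]_n -> R) (hf : QC f) (hg : QC g) (x : 'rV[R]_n) :
  quasi_sum (rearrangement f) (rearrangement g) x
    <= rearrangement (quasi_sum f g) x.
Proof.
have rearr (F : 'rV[R]_n -> R) := @is_rearrangement_rearrangement R n hn F.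
have [QCf' levf] := rearr f (fun t _ => closed_superlevel (t := t) hf)
  (fun t t0 => coord_bounded_superlevel hf t0).
have [_ levg] := rearr g (fun t _ => closed_superlevel (t := t) hg)
  (fun t t0 => coord_bounded_superlevel hg t0).
have [[h0 _ _ _ _] levh] := rearr (quasi_sum f g)
  (fun t t0 => closed_superlevel_quasi_sum hf hg t0)
  (fun t t0 => coord_bounded_superlevel_quasi_sum hf hg t0).
apply: ge_sup.
  by exists (Num.min (rearrangement f x) (rearrangement g 0)), x, 0; rewrite addr0.
move=> _ [y [z [<- ->]]]; set t := Num.min _ _.
(* Superlevel sets are prescribed only at levels in $(0, 1]$. *)
have [t0|t0] := leP t 0; first exact: le_trans (h0 _).
have ty : superlevel t (rearrangement f) y by rewrite /superlevel /= ge_min lexx.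
have tz : superlevel t (rearrangement g) z by rewrite /superlevel /= ge_min lexx orbT.
have t1 : t <= 1 by have [_ _ _ [_ f1] _] := QCf'; exact: le_trans ty (f1 y).
change (superlevel t (rearrangement (quasi_sum f g)) (y + z)).
move: ty tz; rewrite levf // levg // levh // !ball_rearrangementE /= => ry rz.
apply: le_trans (ler_enormD y z) _; apply: le_trans (lerD ry rz) _.
exact: equiradius_superadditive.
Qed.
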